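(* Let $\mathcal{X}$ be a set, let $(\Omega,\mathcal{A},\mu)$ be a measure space, and for each $\omega\in\Omega$ let $\mathcal{H}_\omega$ be a reproducing kernel Hilbert space of functions $\mathcal{X}\to\mathbb{C}$ with reproducing kernel $K_\omega$, scalar product $\langle\cdot,\cdot\rangle_\omega$ and norm $\|\cdot\|_\omega$. Let a measurable structure on the family $(\mathcal{H}_\omega)_{\omega\in\Omega}$ be given (a measurable partition $(\Omega_n)$ of $\Omega$ and isometries $E_\omega$, as described in the context), and let $\tilde{\mathcal{H}}=\int^\oplus_{\omega\in\Omega}\mathcal{H}_\omega$ be the corresponding direct integral with respect to $(\Omega,\mathcal{A},\mu)$, with norm $\|\cdot\|_\sim$. Assume that for every $x\in\mathcal{X}$ the cross-section $\tilde K(\cdot,x)=(K_\omega(\cdot,x))_{\omega\in\Omega}$ belongs to $\tilde{\mathcal{H}}$, i.e. it is measurable and $$\|\tilde K(\cdot,x)\|_\sim^2=\int_\Omega K_\omega(x,x)\,d\mu(\omega)<\infty .$$ Then $$\mathcal{H}=\Bigl\{\int_\Omega f_\omega\,d\mu(\omega)\ :\ (f_\omega)_{\omega\in\Omega}\in\tilde{\mathcal{H}}\Bigr\}$$ (integrals taken pointwise on $\mathcal{X}$) is a reproducing kernel Hilbert space over $\mathcal{X}$ with reproducing kernel $K$ given by $$K(x,y)=\int_\Omega K_\omega(x,y)\,d\mu(\omega)\qquad\text{for all }x,y\in\mathcal{X},$$ and the norm $\|\cdot\|$ on $\mathcal{H}$ is given by $$\|f\|^2=\inf\Bigl\{\int_\Omega\|g_\omega\|_\omega^2\,d\mu(\omega)\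 :\ g\in\tilde{\mathcal{H}},\ f=\int_\Omega g_\omega\,d\mu(\omega)\Bigr\}\qquad\text{for all } f\in\mathcal{H}.$$ Moreover, for every $x\in\mathcal{X}$, $\tilde K(\cdot,x)\in\mathcal{N}(S)^\bot$ and $\|\tilde K(\cdot,x)\|_\sim^2=K(x,x)$, where $S$ is the summation operator $(Sf)(x)=\int_\Omega f_\omega(x)\,d\mu(\omega)$, $f\in\tilde{\mathcal{H}}$, $x\in\mathcal{X}$, and $\mathcal{N}(S)$ is its null space.
   Context: A reproducing kernel Hilbert space over $\mathcal{X}$ is a Hilbert space $\mathcal{H}$ of functions $\mathcal{X}\to\mathbb{C}$ for which there is a function $K:\mathcal{X}\times\mathcal{X}\to\mathbb{C}$ (the reproducing kernel) with $K(\cdot,y)\in\mathcal{H}$ and $f(y)=\langle f,K(\cdot,y)\rangle$ for all $f\in\mathcal{H}$, $y\in\mathcal{X}$ (scalar products are linear in the first argument). Measurable structure: there is a partition of $\Omega$ into measurable sets $\Omega_n\in\mathcal{A}$, $n\in\mathbb{N}\cup\{\infty\}$, and for $\omega\in\Omega_n$ a linear isometry $E_\omega:\mathcal{H}_\omega\to\mathbb{C}^n$, where $\mathbb{C}^\infty$ denotes $\ell_2(\mathbb{C})$. A cross-section is a family $f=(f_\omega)_{\omega\in\Omega}$ with $f_\omega\in\mathcal{H}_\omega$; it is called measurable if for every $n\in\mathbb{N}\cup\{\infty\}$ the map $\Omega_n\to\mathbb{C}^n$, $\omega\mapsto E_\omega f_\omega$, is measurable. Direct integral: $\tilde{\mathcal{H}}=\int^\oplus_{\omega\in\Omega}\mathcal{H}_\omega$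 is the space of measurable cross-sections $f$ with $\int_\Omega\|f_\omega\|_\omega^2\,d\mu(\omega)<\infty$, where $f$ and $g$ are identified if $\int_\Omega\|f_\omega-g_\omega\|_\omega^2\,d\mu(\omega)=0$. It is a Hilbert space with scalar product $\langle f,g\rangle_\sim=\int_\Omega\langle f_\omega,g_\omega\rangle_\omega\,d\mu(\omega)$ and norm $\|f\|_\sim^2=\langle f,f\rangle_\sim$. The operator $S$ maps $\tilde{\mathcal{H}}$ into the space of functions $\mathcal{X}\to\mathbb{C}$. *)

(* Defs.v *)
From HB Require Import structures.
From mathcomp Require Import all_boot all_order all_algebra.
From mathcomp Require Import all_classical all_reals all_analysis.
From mathcomp Require Export complex.
Set Implicit Arguments.
Unset Strict Implicit.
Unset Printing Implicit Defensive.
Import Order.TTheory GRing.Theory Num.Theory.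
Import numFieldNormedType.Exports.
Local Open Scope classical_set_scope.
Local Open Scope ring_scope.
Local Open Scope complex_scope.

Section HilbertSpaces.
Context {R : realType}.

Definition ip_norm (V : Type) (ip : V -> V -> R[i]) (f : V) : R :=
  Num.sqrt (complex.Re (ip f f)).

(* [H] is a Hilbert space for the scalar product [ip], linear in its first
   argument; the values of [ip] outside of [H] are irrelevant. On [R[i]], [0 <= z] means
   that z is real and nonnegative. *)
Record is_hilbert (V : lmodType R[i]) (H : set V) (ip : V -> V -> R[i]) :
    Prop := {
  hilbert0 : H 0 ;
  hilbert_lin : forall a f g, H f -> H g -> H (a *: f + g) ;
  hilbert_ip_lin : forall a f g h, H f -> H g -> H h ->
    ip (a *: f + g) h = a * ip f h + ip g h ;
  hilbert_ip_herm : forall f g, H f -> H g -> ip g f = (ip f g)^* ;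
  hilbert_ip_ge0 : forall f, H f -> 0 <= ip f f ;
  hilbert_ip_def : forall f, H f -> ip f f = 0 -> f = 0 ;
  hilbert_complete : forall u : nat -> V, (forall n, H (u n)) ->
    (forall e : R, 0 < e -> exists N : nat, forall m n : nat,
      (N <= m)%N -> (N <= n)%N -> ip_norm ip (u m - u n) < e) ->
    exists2 l, H l & (fun n => ip_norm ip (u n - l)) @ \oo --> (0 : R)
}.

End HilbertSpaces.

Record rkhs (R : realType) (X : Type) := Rkhs {
  rkhs_space : set (X -> R[i]) ;
  rkhs_ip : (X -> R[i]) -> (X -> R[i]) -> R[i] ;
  rkhs_kernel : X -> X -> R[i] ;
  rkhs_hilbert : is_hilbert rkhs_space rkhs_ip ;
  rkhs_kernel_in : forall y, rkhs_space (rkhs_kernel ^~ y) ;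
  rkhs_reproducing : forall f y, rkhs_space f ->
    f y = rkhs_ip f (rkhs_kernel ^~ y)
}.

Definition rkhs_norm (R : realType) (X : Type) (H : rkhs R X) :
  (X -> R[i]) -> R := ip_norm (rkhs_ip H).

Section SequenceSpaces.
Context {R : realType}.
Implicit Types a b : nat -> R[i].

Definition l2_sqnorm a : \bar R :=
  (\sum_(0 <= k <oo) (ComplexField.Normc.normc (a k) ^+ 2)%:E)%E.

Definition l2_norm a : R := Num.sqrt (fine (l2_sqnorm a)).

(* [Cspace (Some n)] is C^n, realized as the sequences vanishing from index n
   on (with the Euclidean norm [l2_norm]); [Cspace None] is
   C^infinity = l_2(C). *)
Definition Cspace (n : option nat) : set (nat -> R[i]) :=
  [set a | (forall m, n = Some m -> forall k, (m <= k)%N -> a k = 0) /\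
           (l2_sqnorm a < +oo)%E].

Definition Cspace_open (n : option nat) (U : set (nat -> R[i])) : Prop :=
  U `<=` Cspace n /\
  forall a, U a -> exists2 e : R, 0 < e &
    forall b, Cspace n b -> l2_norm (fun k => b k - a k) < e -> U b.

(* Borel measurability for the norm topology of [Cspace n]. *)
Definition Cspace_measurable_fun d (T : measurableType d) (n : option nat)
    (D : set T) (h : T -> nat -> R[i]) : Prop :=
  forall U, Cspace_open n U -> measurable (D `&` h @^-1` U).

End SequenceSpaces.

Section ComplexIntegral.
Context {R : realType} d (T : measurableType d).
Variable mu : {measure set T -> \bar R}.

Definition cintegrable (h : T -> R[i]) : Prop :=
  mu.-integrable setT (fun t => (complex.Re (h t))%:E) /\
  mu.-integrable setT (fun t => (complex.Im (h t))%:E).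

Definition cintegral (h : T -> R[i]) : R[i] :=
  Rintegral mu setT (fun t => complex.Re (h t)) +i*
  Rintegral mu setT (fun t => complex.Im (h t)).

End ComplexIntegral.

(* [ms_part None] is Omega_infinity. The blocks may be empty. *)
Record measurable_structure (R : realType) (X : Type) d
    (Omega : measurableType d) (H : Omega -> rkhs R X) := MeasurableStructure {
  ms_part : option nat -> set Omega ;
  ms_part_measurable : forall n, measurable (ms_part n) ;
  ms_part_trivIset : trivIset setT ms_part ;
  ms_part_cover : \bigcup_n ms_part n = setT ;
  ms_iso : Omega -> (X -> R[i]) -> nat -> R[i] ;
  ms_iso_in : forall n w f, ms_part n w -> rkhs_space (H w) f ->
    Cspace n (ms_iso w f) ;
  ms_iso_lin : forall w (a : R[i]) f g,
    rkhs_space (H w) f -> rkhs_space (H w) g ->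
    ms_iso w (a *: f + g) = a *: ms_iso w f + ms_iso w g ;
  ms_iso_norm : forall w f, rkhs_space (H w) f ->
    l2_norm (ms_iso w f) = rkhs_norm (H w) f
}.

Section DirectIntegral.
Context {R : realType} {X : Type} d (Omega : measurableType d).
Variables (mu : {measure set Omega -> \bar R}) (H : Omega -> rkhs R X).
Variable M : measurable_structure H.
Implicit Types f g : Omega -> X -> R[i].

Definition cross_section f : Prop := forall w, rkhs_space (H w) (f w).

Definition measurable_section f : Prop :=
  cross_section f /\
  forall n, Cspace_measurable_fun n (ms_part M n) (fun w => ms_iso M w (f w)).

Definition di_energy f : \bar R :=
  (\int[mu]_w (rkhs_norm (H w) (f w) ^+ 2)%:E)%E.

(* The elements of the direct integral are given by representatives; all the
   notions below are invariant under the identification of f and g when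
   [di_energy (f - g) = 0]. *)
Definition direct_integral : set (Omega -> X -> R[i]) :=
  [set f | measurable_section f /\ (di_energy f < +oo)%E].

Definition di_ip f g : R[i] :=
  cintegral mu (fun w => rkhs_ip (H w) (f w) (g w)).

Definition di_norm : (Omega -> X -> R[i]) -> R := ip_norm di_ip.

Definition kernel_section (x : X) : Omega -> X -> R[i] :=
  fun w => rkhs_kernel (H w) ^~ x.

(* The operator S, meaningful on [direct_integral]. *)
Definition summation f : X -> R[i] := fun x => cintegral mu (fun w => f w x).

Definition summation_null : set (Omega -> X -> R[i]) :=
  direct_integral `&` [set f | summation f = 0].

Definition di_orthogonal (N : set (Omega -> X -> R[i])) :
    set (Omega -> X -> R[i]) :=
  direct_integral `&` [set g | forall f, N f -> di_ip f g = 0].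

End DirectIntegral.

(* Main.v *)
Require Import Defs.
From HB Require Import structures.
From mathcomp Require Import all_boot all_order all_algebra.
From mathcomp Require Import all_classical all_reals all_analysis.
From mathcomp Require Import ring lra measurable_realfun.
Set Implicit Arguments.
Unset Strict Implicit.
Unset Printing Implicit Defensive.
Import Order.TTheory GRing.Theory Num.Theory.
Import numFieldNormedType.Exports.
Local Open Scope classical_set_scope.
Local Open Scope ring_scope.
Local Open Scope complex_scope.

(** By the reproducing property in each fibre, a section [f] of the direct
    integral satisfies [summation f x = <f, kernel_section x>]: summation is
    the family of all scalar products against the kernel sections. The theorem
    is then a statement about one Hilbert space. If [S f x = <f, k x>] on a
    complete space, then the null space of [S] is the orthogonal complement of
    the [k x], every function in the image of [S] has a preimage of least norm,
    which is the one orthogonal to the null space, and transporting the scalar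
    product along these minimal preimages makes the image a reproducing kernel
    Hilbert space with kernel [<k y, k x>] and with the infimum norm. This is
    [image_rkhs].

    Sections are not identified when they agree almost everywhere, so the
    scalar product of the direct integral is only semidefinite, and the
    abstract part is carried out for complete semi-inner product spaces, in
    which limits and minimal preimages are unique up to null vectors only.

    What remains is that the direct integral is such a space. Measurability of
    a section is defined by open sets of the sequence spaces; since finitely
    supported rational sequences are dense there, it amounts to measurability
    of the countably many coordinate functions ([measurable_sectionP]), and is
    therefore stable under linear combinations and limits. Polarization then
    gives measurability and integrability of all fibrewise scalar products from
    those of the norms. Completeness follows the proof of the Riesz-Fischer
    theorem ([direct_integral_complete]): a fast Cauchy subsequence converges
    in almost every fibre, because the fibres are complete, and Fatou's lemma
    turns this into convergence in the direct integral. The limit is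
    taken in the fibre itself, and its coordinates are limits of coordinates
    because the isometries are norm-continuous. *)

(** * Complete semi-inner product spaces *)

Section Complex.
Context {R : realType}.
Implicit Types x y : R[i].

Lemma ReM x y : complex.Re (x * y) =
  complex.Re x * complex.Re y - complex.Im x * complex.Im y.
Proof. by case: x y => [a b] [c e]. Qed.

Lemma ImM x y : complex.Im (x * y) =
  complex.Re x * complex.Im y + complex.Im x * complex.Re y.
Proof. by case: x y => [a b] [c e]. Qed.

Lemma ReD x y : complex.Re (x + y) = complex.Re x + complex.Re y.
Proof. by case: x y => [a b] [c e]. Qed.

Lemma ImD x y : complex.Im (x + y) = complex.Im x + complex.Im y.
Proof. by case: x y => [a b] [c e]. Qed.

Lemma ReN x : complex.Re (- x) = - complex.Re x.
Proof. by case: x. Qed.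

Lemma ImN x : complex.Im (- x) = - complex.Im x.
Proof. by case: x. Qed.

Lemma ReJ x : complex.Re (x^* ) = complex.Re x.
Proof. by case: x. Qed.

Lemma ImJ x : complex.Im (x^* ) = - complex.Im x.
Proof. by case: x. Qed.

Lemma eq_ReIm x y : complex.Re x = complex.Re y ->
  complex.Im x = complex.Im y -> x = y.
Proof. by case: x y => [a b] [c e] /= -> ->. Qed.

Definition reimE := (ReM, ImM, ReD, ImD, ReN, ImN, ReJ, ImJ).

Lemma sqr_normc x : ComplexField.Normc.normc x ^+ 2 =
  complex.Re x ^+ 2 + complex.Im x ^+ 2.
Proof. by case: x => a b /=; rewrite sqr_sqrtr// addr_ge0 ?sqr_ge0. Qed.

End Complex.

Section SemiInner.
Context {R : realType}.

(** [is_hilbert] without definiteness and completeness; it covers both the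
    fibres and the direct integral, whose elements are representatives of
    classes modulo almost everywhere equality. *)
Record semi_inner (V : lmodType R[i]) (D : set V) (ip : V -> V -> R[i]) :
    Prop := {
  semi_inner0 : D 0 ;
  semi_inner_lin : forall a f g, D f -> D g -> D (a *: f + g) ;
  semi_inner_ip_lin : forall a f g h, D f -> D g -> D h ->
    ip (a *: f + g) h = a * ip f h + ip g h ;
  semi_inner_herm : forall f g, D f -> D g -> ip g f = (ip f g)^* ;
  semi_inner_ge0 : forall f, D f -> 0 <= ip f f
}.

Definition cauchy_complete (V : lmodType R[i]) (D : set V)
    (ip : V -> V -> R[i]) : Prop :=
  forall u : nat -> V, (forall n, D (u n)) ->
    (forall e : R, 0 < e -> exists N : nat, forall m n : nat,
      (N <= m)%N -> (N <= n)%N -> ip_norm ip (u m - u n) < e) ->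
    exists2 l, D l & (fun n => ip_norm ip (u n - l)) @ \oo --> (0 : R).

Definition sqnorm (V : Type) (ip : V -> V -> R[i]) (f : V) : R :=
  complex.Re (ip f f).

Lemma is_hilbert_semi_inner (V : lmodType R[i]) (H : set V) ip :
  is_hilbert H ip -> semi_inner H ip.
Proof. by case=> *; split. Qed.

Lemma is_hilbert_complete (V : lmodType R[i]) (H : set V) ip :
  is_hilbert H ip -> cauchy_complete H ip.
Proof. by case. Qed.

Section Theory.
Variables (V : lmodType R[i]) (D : set V) (ip : V -> V -> R[i]).
Hypothesis hD : semi_inner D ip.
Implicit Types f g h : V.

Lemma semi_innerD f g : D f -> D g -> D (f + g).
Proof. by move=> Df Dg; rewrite -[f]scale1r; apply: (semi_inner_lin hD). Qed.

Lemma semi_innerZ a f : D f -> D (a *: f).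
Proof.
move=> Df; rewrite -[_ *: _]addr0.
by apply: (semi_inner_lin hD) => //; exact: (semi_inner0 hD).
Qed.

Lemma semi_innerB f g : D f -> D g -> D (f - g).
Proof.
move=> Df Dg; apply: semi_innerD => //.
by rewrite -scaleN1r; apply: semi_innerZ.
Qed.

Lemma ipDl f g h : D f -> D g -> D h -> ip (f + g) h = ip f h + ip g h.
Proof.
by move=> *; rewrite -[f]scale1r (semi_inner_ip_lin hD)// mul1r scale1r.
Qed.

Lemma ip0l h : D h -> ip 0 h = 0.
Proof.
move=> Dh; have D0 := semi_inner0 hD.
by apply: (addrI (ip 0 h)); rewrite -ipDl// !addr0.
Qed.

Lemma ipZl a f h : D f -> D h -> ip (a *: f) h = a * ip f h.
Proof.
move=> Df Dh; have D0 := semi_inner0 hD.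
by rewrite -[_ *: _]addr0 (semi_inner_ip_lin hD)// ip0l// addr0.
Qed.

Lemma ipBl f g h : D f -> D g -> D h -> ip (f - g) h = ip f h - ip g h.
Proof.
move=> Df Dg Dh; rewrite -scaleN1r ipDl//; last exact: semi_innerZ.
by rewrite ipZl// mulN1r.
Qed.

Lemma ipDr f g h : D f -> D g -> D h -> ip h (f + g) = ip h f + ip h g.
Proof.
move=> Df Dg Dh; have DD := semi_innerD Df Dg.
rewrite (semi_inner_herm hD DD)// ipDl// (semi_inner_herm hD Df Dh).
by rewrite (semi_inner_herm hD Dg Dh); apply: eq_ReIm; rewrite !reimE//; ring.
Qed.

Lemma ipZr a f h : D f -> D h -> ip h (a *: f) = a^* * ip h f.
Proof.
move=> Df Dh; have DD := semi_innerZ a Df.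
rewrite (semi_inner_herm hD DD)// ipZl// (semi_inner_herm hD Df Dh).
by apply: eq_ReIm; rewrite !reimE//; ring.
Qed.

Lemma sqnorm_ge0 f : D f -> 0 <= sqnorm ip f.
Proof. by move/(semi_inner_ge0 hD); rewrite lecE => /andP[]. Qed.

Lemma Im_ip_diag f : D f -> complex.Im (ip f f) = 0.
Proof. by move/(semi_inner_ge0 hD); exact: ger0_Im. Qed.

Lemma ip_diagE f : D f -> ip f f = (sqnorm ip f)%:C.
Proof. by move=> Df; apply: eq_ReIm => //; rewrite Im_ip_diag. Qed.

Lemma sqr_ip_norm f : D f -> ip_norm ip f ^+ 2 = sqnorm ip f.
Proof. by move=> Df; rewrite sqr_sqrtr// sqnorm_ge0. Qed.

Lemma ip_norm_ge0 f : 0 <= ip_norm ip f.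
Proof. exact: sqrtr_ge0. Qed.

Lemma ReJ_ip f g : D f -> D g -> complex.Re (ip g f) = complex.Re (ip f g).
Proof. by move=> Df Dg; rewrite (semi_inner_herm hD Df Dg) ReJ. Qed.

Lemma sqnormD f g : D f -> D g ->
  sqnorm ip (f + g) = sqnorm ip f + 2 * complex.Re (ip f g) + sqnorm ip g.
Proof.
move=> Df Dg; have DD := semi_innerD Df Dg; rewrite /sqnorm ipDl// !ipDr//.
by rewrite !reimE (ReJ_ip Df Dg); ring.
Qed.

Lemma sqnormZ a f : D f -> sqnorm ip (a *: f) =
  (complex.Re a ^+ 2 + complex.Im a ^+ 2) * sqnorm ip f.
Proof.
move=> Df; have DD := semi_innerZ a Df; rewrite /sqnorm ipZl// ipZr//.
by rewrite !reimE Im_ip_diag//; ring.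
Qed.

Lemma sqnormN f : D f -> sqnorm ip (- f) = sqnorm ip f.
Proof. by move=> Df; rewrite -scaleN1r sqnormZ// !reimE /=; ring. Qed.

Lemma ip_normN f : D f -> ip_norm ip (- f) = ip_norm ip f.
Proof. by move=> Df; rewrite /ip_norm -/(sqnorm ip _) sqnormN. Qed.

Lemma sqnormB f g : D f -> D g ->
  sqnorm ip (f - g) = sqnorm ip f - 2 * complex.Re (ip f g) + sqnorm ip g.
Proof.
move=> Df Dg; rewrite -scaleN1r sqnormD//; last exact: semi_innerZ.
by rewrite ipZr// scaleN1r sqnormN// !reimE /=; ring.
Qed.

Lemma parallelogram f g : D f -> D g ->
  sqnorm ip (f + g) + sqnorm ip (f - g) = 2 * (sqnorm ip f + sqnorm ip g).
Proof. by move=> Df Dg; rewrite sqnormD// sqnormB//; ring. Qed.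

Lemma sqnormD_le f g : D f -> D g ->
  sqnorm ip (f + g) <= 2 * (sqnorm ip f + sqnorm ip g).
Proof.
move=> Df Dg; rewrite -parallelogram// lerDl.
by apply: sqnorm_ge0; apply: semi_innerB.
Qed.

Lemma Re_ipE f g : D f -> D g -> complex.Re (ip f g) =
  2^-1 * (sqnorm ip (f + g) - sqnorm ip f - sqnorm ip g).
Proof. by move=> Df Dg; rewrite sqnormD//; field. Qed.

Lemma Im_ipE f g : D f -> D g ->
  complex.Im (ip f g) = complex.Re (ip f ('i *: g)).
Proof. by move=> Df Dg; rewrite ipZr// !reimE /=; ring. Qed.

(** The real quadratic polynomial [t |-> sqnorm (f + t g)] is nonnegative. Real
    and imaginary parts are bounded separately, which is all that limits of
    scalar products need. *)
Lemma CauchySchwarz_Re f g : D f -> D g ->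
  `|complex.Re (ip f g)| <= ip_norm ip f * ip_norm ip g.
Proof.
move=> Df Dg; set p := complex.Re _.
have P t : 0 <= sqnorm ip f + 2 * t * p + t ^+ 2 * sqnorm ip g.
  have Dt : D (t%:C *: g) by apply: semi_innerZ.
  have := sqnorm_ge0 (semi_innerD Df Dt).
  rewrite sqnormD// ipZr// sqnormZ// !reimE /= -/p => /le_trans -> //.
  by rewrite le_eqVlt; apply/orP; left; apply/eqP; ring.
have f0 := sqnorm_ge0 Df; have g0 := sqnorm_ge0 Dg.
rewrite -(@ler_pXn2r _ 2)// ?nnegrE ?mulr_ge0 ?ip_norm_ge0//.
rewrite exprMn !sqr_ip_norm// real_normK ?num_real//.
have [g_eq0|g_neq0] := eqVneq (sqnorm ip g) 0.
  (* The polynomial is now affine in t, and this t makes its value -1. *)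
  have [->|p0] := eqVneq p 0; first by rewrite expr0n mulr_ge0.
  have := P (- (sqnorm ip f + 1) / (2 * p)); rewrite g_eq0 mulr0 addr0.
  suff -> : sqnorm ip f + 2 * (- (sqnorm ip f + 1) / (2 * p)) * p = - 1.
    by rewrite oppr_ge0 ler10.
  by field.
have g_gt0 : 0 < sqnorm ip g by rewrite lt0r g_neq0.
(* The point where the polynomial is minimal. *)
have := P (- p / sqnorm ip g).
suff -> : sqnorm ip f + 2 * (- p / sqnorm ip g) * p +
   (- p / sqnorm ip g) ^+ 2 * sqnorm ip g =
   (sqnorm ip f * sqnorm ip g - p ^+ 2) / sqnorm ip g.
  by rewrite pmulr_lge0 ?invr_gt0// subr_ge0.
by field.
Qed.

Lemma ip_normZi g : D g -> ip_norm ip ('i *: g) = ip_norm ip g.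
Proof.
move=> Dg; rewrite /ip_norm -!/(sqnorm ip _) sqnormZ//=.
by rewrite expr0n expr1n add0r mul1r.
Qed.

Lemma CauchySchwarz_Im f g : D f -> D g ->
  `|complex.Im (ip f g)| <= ip_norm ip f * ip_norm ip g.
Proof.
move=> Df Dg; rewrite Im_ipE//; have Dig := semi_innerZ 'i Dg.
by rewrite (le_trans (CauchySchwarz_Re Df Dig))// ip_normZi.
Qed.

Lemma ip_norm_triangle f g : D f -> D g ->
  ip_norm ip (f + g) <= ip_norm ip f + ip_norm ip g.
Proof.
move=> Df Dg; have DD := semi_innerD Df Dg.
rewrite -(@ler_pXn2r _ 2)// ?nnegrE ?addr_ge0 ?ip_norm_ge0//.
rewrite sqrrD !sqr_ip_norm// sqnormD// lerD2r lerD2l mulr_natl.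
rewrite lerMn2r /=; apply: le_trans (CauchySchwarz_Re Df Dg).
exact: ler_norm.
Qed.

Lemma ip_norm_distC f g : D f -> D g -> ip_norm ip (f - g) = ip_norm ip (g - f).
Proof. by move=> Df Dg; rewrite -opprB ip_normN//; apply: semi_innerB. Qed.

Lemma ip_norm_sub_triangle h f g : D f -> D g -> D h ->
  ip_norm ip (f - g) <= ip_norm ip (f - h) + ip_norm ip (h - g).
Proof.
move=> Df Dg Dh.
have -> : f - g = (f - h) + (h - g) by rewrite addrA subrK.
by apply: ip_norm_triangle; apply: semi_innerB.
Qed.

(** First-order optimality: a real step [t] changes the squared norm by
    [2 t Re (ip f g) + O(t ^ 2)], so the real part of [ip f g] vanishes; the
    imaginary part is the real part for the direction ['i *: g]. *)
Lemma min_norm_orthogonal f g : D f -> D g ->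
  (forall a, sqnorm ip f <= sqnorm ip (f + a *: g)) -> ip f g = 0.
Proof.
move=> Df Dg fmin.
have Re0 h : D h -> (forall t : R, sqnorm ip f <= sqnorm ip (f + t%:C *: h)) ->
    complex.Re (ip f h) = 0.
  move=> Dh hmin; set p := complex.Re _; have h0 := sqnorm_ge0 Dh.
  (* Adding 1 keeps the step defined when h has norm zero. *)
  have := hmin (- p / (sqnorm ip h + 1)); have Dt a := semi_innerZ a Dh.
  rewrite sqnormD// ipZr// sqnormZ// !reimE /= -/p.
  set s := sqnorm ip h in h0 *; set t := - p / (s + 1).
  have tE : p = - t * (s + 1) by rewrite /t; field; rewrite gt_eqF// ltr_wpDl.
  move=> H; have t0 : t = 0 by rewrite tE in H; nra.
  by rewrite tE t0 oppr0 mul0r.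
apply: eq_ReIm; first by rewrite (Re0 g Dg)// => t; exact: fmin.
rewrite Im_ipE// (Re0 ('i *: g))//; first exact: semi_innerZ.
by move=> t; rewrite scalerA; exact: fmin.
Qed.

(** The substitute for definiteness: a vector of norm zero minimizes the norm
    along every line through it. *)
Lemma ip_null f g : D f -> D g -> sqnorm ip f = 0 -> ip f g = 0.
Proof.
move=> Df Dg f0; apply: min_norm_orthogonal => // a.
by rewrite f0 sqnorm_ge0//; apply: semi_innerD => //; apply: semi_innerZ.
Qed.

End Theory.

Lemma cvg0_lt (u : nat -> R) : u @ \oo --> (0 : R) ->
  forall e : R, 0 < e -> exists N : nat, forall n, (N <= n)%N -> u n < e.
Proof.
move=> /cvgr0Pnorm_lt H e e0; have [N _ HN] := H e e0.
by exists N => n Nn; exact: le_lt_trans (ler_norm _) (HN n Nn).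
Qed.

Lemma lt_cvg0 (u : nat -> R) : (forall n, 0 <= u n) ->
  (forall e : R, 0 < e -> exists N : nat, forall n, (N <= n)%N -> u n < e) ->
  u @ \oo --> (0 : R).
Proof.
move=> u0 H; apply/cvgr0Pnorm_lt => e e0; have [N HN] := H e e0.
by exists N => // n /= Nn; rewrite ger0_norm ?HN.
Qed.

End SemiInner.

(** * Images of complete semi-inner product spaces *)

Section Image.
Context {R : realType}.

(** By the parallelogram law a minimizing sequence in a set closed under
    midpoints is Cauchy; closedness includes invariance under null vectors,
    since limits are not unique. *)
Lemma exists_min_norm (V : lmodType R[i]) (D : set V) ip (A : set V) :
  semi_inner D ip -> cauchy_complete D ip -> A `<=` D -> A !=set0 ->
  (forall f g, A f -> A g -> A ((2^-1 : R)%:C *: (f + g))) ->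
  (forall u l, (forall n, A (u n)) -> D l ->
    (fun n => ip_norm ip (u n - l)) @ \oo --> (0 : R) -> A l) ->
  exists2 m, A m & forall a, A a -> ip_norm ip m <= ip_norm ip a.
Proof.
move=> hD cD AD A0 Amid Acl; set E := [set ip_norm ip a | a in A].
have lbE : lbound E 0 by move=> _ [a _ <-]; exact: ip_norm_ge0.
have infE : has_inf E.
  by split; [case: A0 => a Aa; exists (ip_norm ip a); exists a|exists 0].
set s := inf E.
have s_ge0 : 0 <= s by apply: lb_le_inf => //; case: infE.
have s_le a : A a -> s <= ip_norm ip a.
  by move=> Aa; apply: ge_inf; [exists 0|exists a].
have /choice[u uP] (n : nat) : exists a, A a /\ ip_norm ip a < s + n.+1%:R^-1.
  have e0 : 0 < n.+1%:R^-1 :> R by [].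
  by have [_ [a Aa <-] ae] := inf_adherent e0 infE; exists a.
have Au n : A (u n) by case: (uP n).
have Du n : D (u n) by exact: AD.
have small (e : R) : 0 < e -> exists N : nat, forall n, (N <= n)%N ->
    n.+1%:R^-1 < e.
  exact: cvg0_lt (@cvg_harmonic R) e.
have ucauchy (e : R) : 0 < e -> exists N : nat, forall m n : nat,
    (N <= m)%N -> (N <= n)%N -> ip_norm ip (u m - u n) < e.
  (* If both norms are at most s + c with c <= 1, the parallelogram law bounds
     the squared distance by (8 s + 4) c. *)
  move=> e0; set c := Num.min 1 (e ^+ 2 / (8 * s + 4 + 1)).
  have k_gt0 : 0 < 8 * s + 4 + 1 by lra.
  have c0 : 0 < c by rewrite lt_min ltr01 divr_gt0// exprn_gt0.
  have c1 : c <= 1 by rewrite ge_min lexx.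
  have ce : (8 * s + 4) * c < e ^+ 2.
    have : c <= e ^+ 2 / (8 * s + 4 + 1) by rewrite ge_min lexx orbT.
    by rewrite ler_pdivlMr//; nra.
  have [N HN] := small c c0; exists N => m n Nm Nn.
  have Hs i : (N <= i)%N -> sqnorm ip (u i) <= (s + c) ^+ 2.
    move=> Ni; rewrite -(sqr_ip_norm hD)// ler_pXn2r ?nnegrE ?ip_norm_ge0//.
      by rewrite (le_trans (ltW (proj2 (uP i))))// lerD2l ltW// HN.
    by rewrite addr_ge0// ltW.
  have Hmid : s ^+ 2 <= 4^-1 * sqnorm ip (u m + u n).
    have /s_le := Amid _ _ (Au m) (Au n).
    rewrite -(@ler_pXn2r _ 2)// ?nnegrE ?ip_norm_ge0//.
    rewrite (sqr_ip_norm hD); last by apply: AD; exact: Amid.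
    move=> /le_trans -> //; rewrite (sqnormZ hD)//=; last exact: (semi_innerD hD).
    by rewrite le_eqVlt; apply/orP; left; apply/eqP; field.
  have DB := semi_innerB hD (Du m) (Du n).
  rewrite -(@ltr_pXn2r _ 2)// ?nnegrE ?ip_norm_ge0 ?ltW//.
  rewrite (sqr_ip_norm hD)//; apply: le_lt_trans ce.
  have := parallelogram hD (Du m) (Du n).
  by have := Hs _ Nm; have := Hs _ Nn; nra.
have [l Dl lP] := cD u Du ucauchy.
have Al := Acl u l Au Dl lP; exists l => // a Aa.
apply: le_trans (s_le a Aa); apply/ler_addgt0Pr => e e0.
have [N HN] := cvg0_lt lP (e := e / 2) ltac:(lra).
have [N' HN'] := small (e / 2) ltac:(lra).
set n := maxn N N'.
have -> : l = u n + (l - u n) by rewrite addrC subrK.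
apply: le_trans (ip_norm_triangle hD _ _) _ => //; first exact: (semi_innerB hD).
have := HN n (leq_maxl _ _); rewrite (ip_norm_distC hD)//.
have := HN' n (leq_maxr _ _); have := proj2 (uP n).
by move: n.+1%:R^-1 (ip_norm ip (u n)) (ip_norm ip (l - u n)) => r a1 a2; lra.
Qed.

Variables (X : Type) (V : lmodType R[i]) (D : set V) (ip : V -> V -> R[i]).
Hypotheses (hD : semi_inner D ip) (cD : cauchy_complete D ip).
Variables (k : X -> V) (S : V -> X -> R[i]).
Hypotheses (Dk : forall x, D (k x)).
Hypotheses (SE : forall f x, D f -> S f x = ip f (k x)).

Lemma feature_lin a f g : D f -> D g -> S (a *: f + g) = a *: S f + S g.
Proof.
move=> Df Dg; apply/funext => x.
rewrite SE//; last exact: (semi_inner_lin hD).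
by rewrite (semi_inner_ip_lin hD)// -!SE.
Qed.

(** [S f x] is a scalar product with [f], hence continuous in [f]; so the
    fibres of [S] are closed. *)
Lemma feature_closed u l : (forall n, D (u n)) -> D l ->
  (fun n => ip_norm ip (u n - l)) @ \oo --> (0 : R) ->
  forall h, (forall n, S (u n) = h) -> S l = h.
Proof.
move=> Du Dl ul h uh; apply/funext => x; apply/eqP; rewrite -subr_eq0.
have DB n := semi_innerB hD (Du n) Dl.
have E n : S l x - h x = - ip (u n - l) (k x).
  by rewrite (ipBl hD)// -!SE// uh opprB.
have le0 (r : R) : (forall n, `|r| <= ip_norm ip (u n - l) * ip_norm ip (k x)) -> r = 0.
  move=> H; apply/normr0_eq0/eqP; rewrite eq_le normr_ge0 andbT.
  apply/ler_addgt0Pr => e e0; rewrite add0r; have k0 := ip_norm_ge0 ip (k x).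
  have [|N /(_ N (leqnn _)) HN] := cvg0_lt ul (e := e / (ip_norm ip (k x) + 1)).
    by rewrite divr_gt0// ltr_wpDl.
  move: HN; rewrite ltr_pdivlMr ?ltr_wpDl// => HN.
  have := H N; have := ip_norm_ge0 ip (u N - l); nra.
rewrite eq_complex /=; apply/andP; split; apply/eqP; apply: le0 => n.
  by rewrite (E n) ReN normrN (CauchySchwarz_Re hD).
by rewrite (E n) ImN normrN (CauchySchwarz_Im hD).
Qed.

Lemma exists_min_preimage h : (S @` D) h -> exists g, [/\ D g, S g = h &
  forall g', D g' -> S g' = h -> ip_norm ip g <= ip_norm ip g'].
Proof.
move=> [f Df fh]; pose A := D `&` [set g | S g = h].
have [||||g [Dg gh] gmin] := @exists_min_norm V D ip A hD cD.
- by move=> ? [].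
- by exists f.
- move=> a b [Da Sa] [Db Sb]; have Dab := semi_innerD hD Da Db.
  have DZ := semi_innerZ hD (2^-1 : R)%:C Dab.
  split=> //=; apply/funext => x; rewrite SE// (ipZl hD)// (ipDl hD)//.
  rewrite -!SE// Sa Sb; by apply: eq_ReIm; rewrite !reimE /=; lra.
- move=> u l Au Dl ul; split => //=; apply: (feature_closed _ Dl ul) => n.
    by case: (Au n).
  by case: (Au n).
by exists g; split => // g' Dg' Sg'; exact: gmin.
Qed.

Definition min_preimage (h : X -> R[i]) : V :=
  xget 0 [set g | [/\ D g, S g = h &
    forall g', D g' -> S g' = h -> ip_norm ip g <= ip_norm ip g']].

Lemma min_preimageP h : (S @` D) h -> [/\ D (min_preimage h),
  S (min_preimage h) = h & forall g, D g -> S g = h ->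
    ip_norm ip (min_preimage h) <= ip_norm ip g].
Proof.
move=> /exists_min_preimage[g gP]; rewrite /min_preimage.
by case: xgetP => [m _ //|/(_ g)].
Qed.

Local Notation m := min_preimage.

Lemma min_preimage_in h : (S @` D) h -> D (m h).
Proof. by case/min_preimageP. Qed.

Lemma min_preimageK h : (S @` D) h -> S (m h) = h.
Proof. by case/min_preimageP. Qed.

Lemma min_preimage_orth h f : (S @` D) h -> D f -> S f = 0 -> ip (m h) f = 0.
Proof.
move=> Sh Df f0; have [Dm Sm minm] := min_preimageP Sh.
apply: (min_norm_orthogonal hD) => // a.
have DD : D (m h + a *: f) by apply: (semi_innerD hD) => //; exact: (semi_innerZ hD).
rewrite -!(sqr_ip_norm hD)// ler_pXn2r ?nnegrE ?ip_norm_ge0//; apply: minm => //.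
by rewrite addrC feature_lin// f0 Sm scaler0 add0r.
Qed.

(** The difference [f - g] lies in the null space of [S] and is orthogonal to
    it, so it has norm zero and no scalar product sees it. *)
Lemma orth_null_unique f g h : D f -> D g -> D h -> S f = S g ->
  (forall v, D v -> S v = 0 -> ip f v = 0) ->
  (forall v, D v -> S v = 0 -> ip g v = 0) -> ip f h = ip g h.
Proof.
move=> Df Dg Dh fg f0 g0; apply/eqP; rewrite -subr_eq0 -(ipBl hD)//.
have DB := semi_innerB hD Df Dg.
have S0 : S (f - g) = 0.
  by rewrite addrC -scaleN1r feature_lin// fg scaleN1r addNr.
apply/eqP/(ip_null hD) => //.
by rewrite /sqnorm (ipBl hD)// f0// g0// subrr.
Qed.

(** The scalar product of the quotient by the null space of [S], read off on
    the minimal preimages, which form a copy of the quotient. *)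
Definition image_ip (h1 h2 : X -> R[i]) : R[i] := ip (m h1) (m h2).

Lemma image_lin a h1 h2 :
  (S @` D) h1 -> (S @` D) h2 -> (S @` D) (a *: h1 + h2).
Proof.
move=> [f Df <-] [g Dg <-]; exists (a *: f + g).
  exact: (semi_inner_lin hD).
by rewrite feature_lin.
Qed.

(** [min_preimage] need not be linear, as it chooses among vectors that differ
    by null vectors, but scalar products do not see the choice. *)
Lemma ip_min_preimage_lin a h1 h2 f : (S @` D) h1 -> (S @` D) h2 -> D f ->
  ip (m (a *: h1 + h2)) f = a * ip (m h1) f + ip (m h2) f.
Proof.
move=> H1 H2 Df; have H12 := image_lin a H1 H2.
have D1 := min_preimage_in H1; have D2 := min_preimage_in H2.
rewrite -(semi_inner_ip_lin hD)//; apply: orth_null_unique => //.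
- exact: min_preimage_in.
- exact: (semi_inner_lin hD).
- by rewrite feature_lin// !min_preimageK.
- by move=> v Dv Sv; exact: min_preimage_orth.
move=> v Dv Sv; rewrite (semi_inner_ip_lin hD)//.
by rewrite !min_preimage_orth// mulr0 addr0.
Qed.

Lemma ip_min_preimageB h1 h2 f : (S @` D) h1 -> (S @` D) h2 -> D f ->
  ip (m (h1 - h2)) f = ip (m h1 - m h2) f.
Proof.
move=> H1 H2 Df; rewrite [h1 - h2]addrC -(scaleN1r h2) ip_min_preimage_lin//.
have D1 := min_preimage_in H1; have D2 := min_preimage_in H2.
by rewrite (ipBl hD)// mulN1r addrC.
Qed.

(** For completeness, minimal preimages of a Cauchy sequence are Cauchy; if [l]
    is their limit, then [u n - S l] has [m (u n) - l] among its preimages, so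
    its norm is at most the distance from [m (u n)] to [l]. *)
Lemma image_hilbert : is_hilbert (S @` D) image_ip.
Proof.
have Dm := min_preimage_in; split.
- exists 0; first exact: (semi_inner0 hD).
  by apply/funext => x; rewrite SE ?(ip0l hD)//; exact: (semi_inner0 hD).
- exact: image_lin.
- by move=> a f g h Sf Sg Sh; apply: ip_min_preimage_lin => //; exact: Dm.
- by move=> f g Sf Sg; apply: (semi_inner_herm hD); exact: Dm.
- by move=> f Sf; apply: (semi_inner_ge0 hD); exact: Dm.
- move=> f Sf f0; apply/funext => x.
  rewrite -(min_preimageK Sf) SE ?(ip_null hD)//; try exact: Dm.
  by rewrite /sqnorm -/(image_ip f f) f0.
move=> u Su ucauchy.
have SB a b : (S @` D) a -> (S @` D) b -> (S @` D) (a - b).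
  by move=> Sa Sb; rewrite addrC -scaleN1r; apply: image_lin.
have DB n p : D (m (u n) - m (u p)).
  by apply: (semi_innerB hD); apply: Dm.
have E n p : ip_norm image_ip (u n - u p) = ip_norm ip (m (u n) - m (u p)).
  have DD := Dm _ (SB _ _ (Su n) (Su p)).
  rewrite /ip_norm /image_ip ip_min_preimageB// (semi_inner_herm hD)//.
  by rewrite ip_min_preimageB// ReJ.
have [||l Dl lP] := cD (u := m \o u); first by move=> n; exact: Dm.
  move=> e e0; have [N HN] := ucauchy e e0; exists N => a b Na Nb.
  by rewrite -E; exact: HN.
exists (S l); first by exists l.
apply: lt_cvg0 => [n|e e0]; first exact: ip_norm_ge0.
have [N HN] := cvg0_lt lP e0; exists N => n Nn; apply: le_lt_trans (HN n Nn).
have SSl : (S @` D) (S l) by exists l.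
have [_ _] := min_preimageP (SB _ _ (Su n) SSl); apply.
  by apply: (semi_innerB hD) => //; exact: Dm.
rewrite addrC -scaleN1r feature_lin//; last exact: Dm.
by rewrite /= min_preimageK// scaleN1r addrC.
Qed.

Lemma image_kernel_in y : (S @` D) (fun x => S (k y) x).
Proof. by exists (k y). Qed.

(** [k y] is orthogonal to the null space of [S], so it agrees with the minimal
    preimage of its image up to a null vector. *)
Lemma image_reproducing h y : (S @` D) h ->
  h y = image_ip h (fun x => S (k y) x).
Proof.
move=> Sh; have Sk : (S @` D) (S (k y)) by exists (k y).
have Dh := min_preimage_in Sh; have Dmk := min_preimage_in Sk.
rewrite /image_ip (semi_inner_herm hD Dmk Dh).
rewrite (@orth_null_unique _ (k y))//; last 3 first.
- by rewrite min_preimageK.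
- by move=> v Dv Sv; exact: min_preimage_orth.
- by move=> v Dv Sv; rewrite (semi_inner_herm hD Dv)// -SE// Sv conjc0.
by rewrite -(semi_inner_herm hD)// -SE// min_preimageK.
Qed.

(** The clause on norms gives the infimum over all preimages together with the
    fact that it is attained. *)
Theorem image_rkhs : exists HH : rkhs R X,
  [/\ rkhs_space HH = S @` D,
      forall x y, rkhs_kernel HH x y = S (k y) x &
      forall h, rkhs_space HH h -> exists g, [/\ D g, S g = h,
        rkhs_norm HH h = ip_norm ip g &
        forall g', D g' -> S g' = h -> ip_norm ip g <= ip_norm ip g']].
Proof.
exists (@Rkhs R X _ _ (fun x y => S (k y) x) image_hilbert image_kernel_in
  image_reproducing); split => // h Sh.
by have [Dm Sm minm] := min_preimageP Sh; exists (m h).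
Qed.

End Image.

(** * Measurability in coordinates *)

Section SquareSummable.
Context {R : realType}.
Implicit Types a b : nat -> R[i].
Local Open Scope ereal_scope.

Lemma l2_sqnorm_ge0 a : 0 <= l2_sqnorm a.
Proof. by apply: nneseries_ge0 => k _ _; rewrite lee_fin sqr_ge0. Qed.

Lemma sqr_normcB (x y : R[i]) : (ComplexField.Normc.normc (x - y) ^+ 2 <=
  2 * (ComplexField.Normc.normc x ^+ 2 + ComplexField.Normc.normc y ^+ 2))%R.
Proof.
rewrite !sqr_normc !reimE.
have := sqr_ge0 (complex.Re x + complex.Re y)%R.
by have := sqr_ge0 (complex.Im x + complex.Im y)%R; nra.
Qed.

Lemma l2_sqnormB a b :
  l2_sqnorm (fun k => a k - b k)%R <= 2%:E * (l2_sqnorm a + l2_sqnorm b).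
Proof.
rewrite /l2_sqnorm -nneseriesD; try by move=> *; rewrite lee_fin sqr_ge0.
rewrite -nneseriesZl; last by move=> *; rewrite -EFinD lee_fin addr_ge0 ?sqr_ge0.
apply: lee_nneseries => [k _ _|k _]; first by rewrite lee_fin sqr_ge0.
by rewrite -EFinD -EFinM lee_fin sqr_normcB.
Qed.

Lemma l2_sqnormB_fin a b : l2_sqnorm a < +oo -> l2_sqnorm b < +oo ->
  l2_sqnorm (fun k => a k - b k)%R < +oo.
Proof.
move=> a_fin b_fin; apply: le_lt_trans (l2_sqnormB a b) _.
by rewrite lte_mul_pinfty// lte_add_pinfty.
Qed.

Lemma l2_sqnormE a : l2_sqnorm a < +oo -> l2_sqnorm a = (l2_norm a ^+ 2)%:E.
Proof.
move=> a_fin; rewrite sqr_sqrtr ?fine_ge0 ?l2_sqnorm_ge0// fineK//.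
by rewrite ge0_fin_numE// l2_sqnorm_ge0.
Qed.

Lemma l2_norm_lt a (e : R) : (0 < e)%R -> l2_sqnorm a < +oo ->
  (l2_norm a < e)%R = (l2_sqnorm a < (e ^+ 2)%:E).
Proof.
move=> e0 a_fin; rewrite l2_sqnormE// lte_fin.
by rewrite ltr_pXn2r// ?nnegrE ?sqrtr_ge0// ltW.
Qed.

Lemma coord_le_l2 a k :
  (ComplexField.Normc.normc (a k) ^+ 2)%:E <= l2_sqnorm a.
Proof.
have P0 i : 0 <= (ComplexField.Normc.normc (a i) ^+ 2)%:E.
  by rewrite lee_fin sqr_ge0.
apply: le_trans (nneseries_lim_ge k.+1 _) => [|//].
by rewrite big_nat_recr//= leeDr// sume_ge0.
Qed.

Lemma coord_lt_l2 a (e : R) k : (0 < e)%R -> l2_sqnorm a < +oo ->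
  (l2_norm a < e)%R ->
  (`|complex.Re (a k)| < e)%R /\ (`|complex.Im (a k)| < e)%R.
Proof.
move=> e0 a_fin; rewrite l2_norm_lt// => /(le_lt_trans (coord_le_l2 a k)).
rewrite lte_fin sqr_normc => He.
split; rewrite -(@ltr_pXn2r _ 2)// ?nnegrE ?normr_ge0 ?ltW// real_normK ?num_real//.
  by apply: le_lt_trans He; rewrite lerDl sqr_ge0.
by apply: le_lt_trans He; rewrite lerDr sqr_ge0.
Qed.

(** Coding by finite lists makes this family of sequences countable. *)
Definition rat_sequence (s : seq (rat * rat)) (k : nat) : R[i] :=
  ratr (nth (0, 0)%R s k).1 +i* ratr (nth (0, 0)%R s k).2.

Lemma rat_approx (x e : R) : (0 < e)%R ->
  exists q : rat, ((x - ratr q) ^+ 2 < e)%R.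
Proof.
move=> e0; pose c := Num.min 1%R e.
have c0 : (0 < c)%R by rewrite lt_min ltr01.
have c1 : (c <= 1)%R by rewrite ge_min lexx.
have ce : (c <= e)%R by rewrite ge_min lexx orbT.
have [|q] := @rat_in_itvoo R (x - c) (x + c); first by lra.
by rewrite in_itv /= => /andP[q1 q2]; exists q; nra.
Qed.

(** Density of the finitely supported rational sequences: cut off a tail of
    total weight less than [e / 2] and approximate the remaining [N] entries
    with squared errors at most [e / (2 (N + 1))]. *)
Lemma rat_sequence_dense a (e : R) : (0 < e)%R -> l2_sqnorm a < +oo ->
  exists s, l2_sqnorm (fun k => a k - rat_sequence s k)%R < e%:E.
Proof.
move=> e0 a_fin.
have P0 (b : nat -> R[i]) k : 0 <= (ComplexField.Normc.normc (b k) ^+ 2)%:E.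
  by rewrite lee_fin sqr_ge0.
have e2 : (0 < e / 2)%R by rewrite divr_gt0.
have [N tailN] : exists N, \sum_(N <= k <oo)
    (ComplexField.Normc.normc (a k) ^+ 2)%:E < (e / 2)%:E.
  have := @nneseries_tail_cvg R _ xpredT a_fin (fun k _ => P0 a k).
  move=> /(_ [set x | x < (e / 2)%:E]) [].
    by apply: open_nbhs_nbhs; split; [exact: open_ereal_lt_ereal|rewrite /= lte_fin].
  by move=> N _ /(_ N (leqnn _)); exists N.
pose r := (e / 2 / N.+1%:R / 2)%R.
have r0 : (0 < r)%R by rewrite !divr_gt0.
have /choice[t tP] k : exists p : rat * rat,
    ((complex.Re (a k) - ratr p.1) ^+ 2 + (complex.Im (a k) - ratr p.2) ^+ 2
      <= e / 2 / N.+1%:R)%R.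
  have [q qP] := rat_approx (complex.Re (a k)) r0.
  have [q' q'P] := rat_approx (complex.Im (a k)) r0.
  exists (q, q') => /=; rewrite (splitr (e / 2 / N.+1%:R)%R).
  by apply: lerD; exact: ltW.
exists (mkseq t N).
rewrite /l2_sqnorm (nneseries_split 0 N) => [|k _]; last first.
  exact: (P0 (fun k => a k - _)%R).
rewrite add0n (splitr e) EFinD lee_ltD//.
- rewrite big_mkord sumEFin.
  by rewrite fin_numE.
- rewrite big_mkord sumEFin lee_fin.
  apply: (@le_trans _ _ (\sum_(i < N) (e / 2 / N.+1%:R))%R).
    apply: ler_sum => k _; rewrite sqr_normc !reimE /= nth_mkseq//.
  rewrite sumr_const card_ord -[X in (X <= _)%R]mulr_natr mulrAC -mulrA.
  by rewrite ger_pMr// ler_pdivrMr// mul1r ler_nat.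
rewrite [ltLHS](_ : _ = \sum_(N <= k <oo)
  (ComplexField.Normc.normc (a k) ^+ 2)%:E)//.
apply/congr_lim/funext => n; apply: eq_big_nat => k /andP[Nk _].
rewrite /rat_sequence nth_default ?size_mkseq//= rmorph0.
by rewrite (_ : (a k - _)%R = a k)// -[RHS]subr0.
Qed.

End SquareSummable.

Section CoordinateMeasurability.
Context {R : realType} d (T : measurableType d).
Implicit Types (D : set T) (h : T -> nat -> R[i]) (n : option nat).

(** Coordinates are 1-Lipschitz for the norm, so the preimages of open rays
    under them are open. *)
Lemma Cspace_measurable_fun_ReIm n D h : measurable D ->
  (forall w, D w -> Cspace n (h w)) -> Cspace_measurable_fun n D h ->
  forall k, measurable_fun D (fun w => complex.Re (h w k)) /\
            measurable_fun D (fun w => complex.Im (h w k)).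
Proof.
move=> mD hC mh k.
have key (p : R[i] -> R) :
    (forall a b (e : R), 0 < e -> Cspace n a -> Cspace n b ->
      l2_norm (fun k => b k - a k) < e -> p (a k) < p (b k) + e) ->
    measurable_fun D (fun w => p (h w k)).
  move=> pP _; apply: (measurability _ (RGenOInfty.measurableE R)) => //.
  move=> /= _ [_ [c ->] <-]; rewrite preimage_itvoy.
  pose U := [set a | Cspace n a /\ c < p (a k)].
  rewrite [X in measurable X](_ : _ = D `&` h @^-1` U); last first.
    by apply/seteqP; split=> w /= [Dw]; [split => //; split => //; exact: hC|case].
  apply: mh; split; first by move=> a [].
  move=> a [Ca ca]; exists (p (a k) - c); first by rewrite subr_gt0.
  by move=> b Cb /pP H; split => //; have := H ltac:(lra) Ca Cb; lra.
by split; apply: key => a b e e0 [_ Ca] [_ Cb] ab;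
  have [] := coord_lt_l2 k e0 (l2_sqnormB_fin Cb Ca) ab;
  rewrite !reimE ltr_norml => /andP[]; rewrite ?ltr_norml => *; lra.
Qed.

Lemma measurable_l2_sqnorm D h a :
  (forall k, measurable_fun D (fun w => complex.Re (h w k)) /\
             measurable_fun D (fun w => complex.Im (h w k))) ->
  measurable_fun D (fun w => l2_sqnorm (fun k => h w k - a k)).
Proof.
move=> mh; apply: (@ge0_emeasurable_sum _ _ _ _ _ xpredT) => [k w _ _|k _].
  by rewrite lee_fin sqr_ge0.
apply/measurable_EFinP.
under eq_fun do rewrite sqr_normc !reimE.
have [mRe mIm] := mh k.
by apply: measurable_funD; apply: measurable_funX; apply: measurable_funD.
Qed.

(** Separability: an open set is the union of the balls that it contains with
    finitely supported rational centre and radius [1 / (j + 1)], and the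
    distance to a fixed centre is a measurable series of the coordinates. *)
Lemma ReIm_Cspace_measurable_fun n D h : measurable D ->
  (forall w, D w -> Cspace n (h w)) ->
  (forall k, measurable_fun D (fun w => complex.Re (h w k)) /\
             measurable_fun D (fun w => complex.Im (h w k))) ->
  Cspace_measurable_fun n D h.
Proof.
move=> mD hC mh U [UC Uopen].
pose B (p : seq (rat * rat) * nat) : set (nat -> R[i]) := [set b |
  (l2_sqnorm (fun k => (b k - rat_sequence p.1 k)%R) < (p.2.+1%:R^-1 ^+ 2)%:E)%E].
pose F (p : seq (rat * rat) * nat) : set T :=
  if `[< B p `&` Cspace n `<=` U >] then D `&` h @^-1` B p else set0.
rewrite (_ : _ `&` _ = \bigcup_p F p).
  apply: countable_bigcupT_measurable; first exact: countableP.
  move=> p; rewrite /F; case: ifP => // _.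
  by apply: emeasurable_fun_infty_o => //; exact: measurable_l2_sqnorm.
apply/seteqP; split => [w /= [Dw Uw]|w [p _]]; last first.
  rewrite /F; case: ifPn => // /asboolP BU [Dw Bw]; split => //.
  by apply: BU; split => //; exact: hC.
have [n_ a_fin] := hC w Dw; have [e e0 eU] := Uopen _ Uw.
(* With both distances to the centre less than r, the squared distance is less
   than 4 r ^ 2, since the inequality used for it is sqr (x - y) <= 2 sqr x +
   2 sqr y. *)
have [j] : exists j : nat, j.+1%:R^-1 < e / 2.
  have [|N /(_ N (leqnn _)) HN] := cvg0_lt (@cvg_harmonic R) (e := e / 2).
    by rewrite divr_gt0.
  by exists N.
set r : R := j.+1%:R^-1 => re; have r0 : 0 < r by rewrite invr_gt0.
have [s sP] := rat_sequence_dense (exprn_gt0 2 r0) a_fin.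
exists (s, j) => //; rewrite /F; case: ifPn => [//|/asboolP]; case.
move=> b [Bb Cb]; apply: eU => //.
rewrite l2_norm_lt//; last by apply: l2_sqnormB_fin => //; case: Cb.
rewrite [X in l2_sqnorm X](_ : _ = fun k => (b k - rat_sequence s k) -
    (h w k - rat_sequence s k)); last first.
  by apply/funext => k; rewrite opprB addrA subrK.
apply: le_lt_trans (l2_sqnormB _ _) _.
apply: (@lt_trans _ _ (2%:E * ((r ^+ 2)%:E + (r ^+ 2)%:E))%E).
  rewrite lte_pmul2l// lteD//.
by rewrite -EFinD -EFinM lte_fin; nra.
Qed.

End CoordinateMeasurability.

(** * Measurable sections *)

Section Sections.
Context {R : realType} {X : Type} d (Omega : measurableType d).
Variables (H : Omega -> rkhs R X) (M : measurable_structure H).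
Implicit Types f g : Omega -> X -> R[i].

Local Notation ipw w := (rkhs_ip (H w)).
Local Notation q f := (fun w => sqnorm (rkhs_ip (H w)) (f w)).

Lemma fibre_semi_inner w : semi_inner (rkhs_space (H w)) (ipw w).
Proof. exact: is_hilbert_semi_inner (rkhs_hilbert (H w)). Qed.

Lemma fibre_complete w : cauchy_complete (rkhs_space (H w)) (ipw w).
Proof. exact: is_hilbert_complete (rkhs_hilbert (H w)). Qed.

Lemma ms_part_ex w : exists n, ms_part M n w.
Proof.
have : (\bigcup_n ms_part M n) w by rewrite ms_part_cover.
by case=> n _ ?; exists n.
Qed.

Lemma ms_iso_fin w (u : X -> R[i]) : rkhs_space (H w) u ->
  (l2_sqnorm (ms_iso M w u) < +oo)%E.
Proof. by have [n nw] := ms_part_ex w => /(ms_iso_in nw)[]. Qed.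

Lemma ms_iso_sqnorm w (u : X -> R[i]) : rkhs_space (H w) u ->
  l2_sqnorm (ms_iso M w u) = (sqnorm (ipw w) u)%:E.
Proof.
move=> Hu; rewrite l2_sqnormE ?ms_iso_fin// ms_iso_norm// /rkhs_norm.
by rewrite (sqr_ip_norm (fibre_semi_inner w)).
Qed.

Lemma cross_section_lin a f g :
  cross_section H f -> cross_section H g -> cross_section H (a *: f + g).
Proof.
by move=> Hf Hg w; apply: (semi_inner_lin (fibre_semi_inner w)).
Qed.

(** In contrast to [measurable_section], this does not mention the partition,
    so that it can be checked on the whole space at once. *)
Definition measurable_coords f : Prop := forall k,
  measurable_fun setT (fun w => complex.Re (ms_iso M w (f w) k)) /\
  measurable_fun setT (fun w => complex.Im (ms_iso M w (f w) k)).

(** The partition is countable: [0] indexes the infinite-dimensional block and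
    [j + 1] the block of dimension [j]. *)
Lemma measurable_funT_partP (p : Omega -> R) : measurable_fun setT p <->
  forall n, measurable_fun (ms_part M n) p.
Proof.
pose e (i : nat) := if i is j.+1 then Some j else None.
have cover : setT = \bigcup_i ms_part M (e i).
  apply/esym; rewrite -subTset => w _; have [[j|] nw] := ms_part_ex w.
    by exists j.+1.
  by exists 0%N.
rewrite cover measurable_fun_bigcup; last by move=> i; exact: ms_part_measurable.
split=> [mp [j|]|mp i]; [exact: (mp j.+1)|exact: (mp 0%N)|exact: mp].
Qed.

Lemma measurable_sectionP f :
  measurable_section M f <-> cross_section H f /\ measurable_coords f.
Proof.
split=> [[Hf mf]|[Hf mf]]; split => //.
- move=> k; have mE n := @Cspace_measurable_fun_ReIm _ _ _ n _ _
    (ms_part_measurable M n) (fun w nw => ms_iso_in nw (Hf w)) (mf n) k.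
  by split; apply/measurable_funT_partP => n; case: (mE n).
- move=> n; apply: ReIm_Cspace_measurable_fun; first exact: ms_part_measurable.
    by move=> w nw; exact: ms_iso_in.
  move=> k; have [mRe mIm] := mf k.
  by split; apply: measurable_funTS.
Qed.

Lemma measurable_section_lin a f g : measurable_section M f ->
  measurable_section M g -> measurable_section M (a *: f + g).
Proof.
move=> /measurable_sectionP[Hf mf] /measurable_sectionP[Hg mg].
apply/measurable_sectionP; split; first exact: cross_section_lin.
move=> k; have [mfR mfI] := mf k; have [mgR mgI] := mg k.
have E w : ms_iso M w ((a *: f + g) w) k =
    a * ms_iso M w (f w) k + ms_iso M w (g w) k.
  by rewrite -[LHS]/(ms_iso M w (a *: f w + g w) k) ms_iso_lin.
split; under eq_fun do rewrite E !reimE.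
  apply: measurable_funD => //; apply: measurable_funB.
    by apply: measurable_funM => //; exact: measurable_cst.
  by apply: measurable_funM => //; exact: measurable_cst.
apply: measurable_funD => //; apply: measurable_funD.
  by apply: measurable_funM => //; exact: measurable_cst.
by apply: measurable_funM => //; exact: measurable_cst.
Qed.

Lemma ms_iso0 w : ms_iso M w 0 = 0.
Proof.
have H0 := semi_inner0 (fibre_semi_inner w).
have := ms_iso_lin M 1 H0 H0; rewrite !scale1r addr0.
by move=> /(congr1 (fun z => z - ms_iso M w 0)); rewrite subrr addrK.
Qed.

Lemma measurable_section0 : measurable_section M 0.
Proof.
apply/measurable_sectionP; split=> [w|k].
  exact: (semi_inner0 (fibre_semi_inner w)).
by split; under eq_fun do rewrite ms_iso0; exact: measurable_cst.
Qed.

Lemma measurable_sqnorm f :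
  measurable_section M f -> measurable_fun setT (q f).
Proof.
move=> /measurable_sectionP[Hf mf]; apply/measurable_EFinP.
have := measurable_l2_sqnorm 0 mf; apply: eq_measurable_fun => w _ /=.
rewrite -ms_iso_sqnorm//; congr l2_sqnorm.
by apply/funext => k; rewrite subr0.
Qed.

(** Coordinates of an isometry are norm-continuous, so those of the limit are
    pointwise limits of measurable functions. *)
Lemma measurable_section_cvg (u : nat -> Omega -> X -> R[i]) f :
  (forall n, measurable_section M (u n)) -> cross_section H f ->
  (forall w, (fun n => ip_norm (ipw w) (u n w - f w)) @ \oo --> (0 : R)) ->
  measurable_section M f.
Proof.
move=> mu Hf uf; apply/measurable_sectionP; split => // k.
have Hu n : cross_section H (u n) by case: (mu n).
have key w (e : R) : 0 < e -> exists N : nat, forall n, (N <= n)%N ->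
  `|complex.Re (ms_iso M w (u n w) k) - complex.Re (ms_iso M w (f w) k)| < e /\
  `|complex.Im (ms_iso M w (u n w) k) - complex.Im (ms_iso M w (f w) k)| < e.
  move=> e0; have [N HN] := cvg0_lt (uf w) e0; exists N => n Nn.
  have hw := fibre_semi_inner w.
  have HB := semi_innerB hw (Hu n w) (Hf w).
  have := HN n Nn; rewrite -/(rkhs_norm (H w) _) -(ms_iso_norm M HB).
  move=> /(coord_lt_l2 k e0 (ms_iso_fin HB)).
  have -> : u n w - f w = (-1) *: f w + u n w by rewrite scaleN1r addrC.
  rewrite (ms_iso_lin M _ (Hf w) (Hu n w)) scaleN1r !fctE !reimE.
  by rewrite ![- _ + _]addrC.
split.
  apply: (measurable_fun_cvg (h := fun n w => complex.Re (ms_iso M w (u n w) k))).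
    by move=> n; have /measurable_sectionP[_ /(_ k)[]] := mu n.
  move=> w _; apply/cvgrPdist_lt => e e0; have [N HN] := key w e e0.
  by exists N => // n Nn; rewrite distrC; case: (HN n Nn).
apply: (measurable_fun_cvg (h := fun n w => complex.Im (ms_iso M w (u n w) k))).
  by move=> n; have /measurable_sectionP[_ /(_ k)[]] := mu n.
move=> w _; apply/cvgrPdist_lt => e e0; have [N HN] := key w e e0.
by exists N => // n Nn; rewrite distrC; case: (HN n Nn).
Qed.

(** Used to discard an exceptional set on which a sequence need not converge. *)
Lemma measurable_section_restrict f (N : set Omega) : measurable N ->
  measurable_section M f ->
  measurable_section M (fun w => if `[< N w >] then 0 else f w).
Proof.
move=> mN /measurable_sectionP[Hf mf]; apply/measurable_sectionP; split.
  by move=> w; case: ifP => // _; exact: (semi_inner0 (fibre_semi_inner w)).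
have mb : measurable_fun setT (fun w => `[< N w >]).
  apply: (measurable_fun_bool true); rewrite setTI.
  by rewrite (_ : _ @^-1` _ = N)//; apply/seteqP; split => w /asboolP.
move=> k; have [mR mI] := mf k.
have E w : ms_iso M w (if `[< N w >] then 0 else f w) k =
    if `[< N w >] then 0 else ms_iso M w (f w) k.
  by case: ifP => // _; rewrite ms_iso0.
split; [under eq_fun do rewrite E (fun_if (@complex.Re R))
       |under eq_fun do rewrite E (fun_if (@complex.Im R))];
  by apply: measurable_fun_ifT => //; exact: measurable_cst.
Qed.

End Sections.

(** * Completeness of the direct integral *)

Section SemiInnerLimits.
Context {R : realType} (V : lmodType R[i]) (D : set V) (ip : V -> V -> R[i]).
Hypothesis hD : semi_inner D ip.

Lemma sqnorm_cvg (v : nat -> V) a l : D a -> D l -> (forall n, D (v n)) ->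
  (fun n => ip_norm ip (v n - l)) @ \oo --> (0 : R) ->
  (fun n => sqnorm ip (a - v n)) @ \oo --> sqnorm ip (a - l).
Proof.
move=> Da Dl Dv vl.
have DB n := semi_innerB hD Da (Dv n); have DBl := semi_innerB hD Da Dl.
under eq_fun do rewrite -(sqr_ip_norm hD)//.
rewrite -(sqr_ip_norm hD)//; under eq_fun do rewrite expr2; rewrite expr2.
suff nl : (fun n => ip_norm ip (a - v n)) @ \oo --> ip_norm ip (a - l).
  exact: cvgM.
apply/cvgrPdist_lt => e e0; have [N HN] := cvg0_lt vl e0.
exists N => // n /= Nn; apply: le_lt_trans (HN n Nn).
have := ip_norm_sub_triangle hD Da Dl (Dv n).
have := ip_norm_sub_triangle hD Da (Dv n) Dl.
by rewrite (ip_norm_distC hD Dl (Dv n)) ler_norml => *; apply/andP; split; lra.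
Qed.

(** The squared steps are at most [C / 4 ^ n], so the steps themselves are at
    most [sqrt C / 2 ^ n] and sum to a telescoping bound. *)
Lemma cvg_geometric_steps (v : nat -> V) (C : R) :
  cauchy_complete D ip -> (forall n, D (v n)) ->
  (forall n, 4 ^+ n * sqnorm ip (v n.+1 - v n) <= C) ->
  exists2 l, D l & (fun n => ip_norm ip (v n - l)) @ \oo --> (0 : R).
Proof.
move=> cD Dv vC.
have C0 : 0 <= C.
  apply: le_trans (vC 0%N); rewrite mulr_ge0//.
  by apply: (sqnorm_ge0 hD); exact: (semi_innerB hD).
pose c := Num.sqrt C.
have p0 n : 0 < 2 ^+ n :> R by rewrite exprn_gt0.
have step n : ip_norm ip (v n.+1 - v n) <= c / 2 ^+ n.
  have DB := semi_innerB hD (Dv n.+1) (Dv n).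
  have n0 : 0 <= ip_norm ip (v n.+1 - v n) * 2 ^+ n.
    by rewrite mulr_ge0 ?ip_norm_ge0 ?exprn_ge0.
  rewrite ler_pdivlMr// -(@ler_pXn2r _ 2)// ?nnegrE ?sqrtr_ge0//.
  rewrite exprMn (sqr_ip_norm hD)// sqr_sqrtr// exprAC mulrC.
  by rewrite (_ : 2 ^+ 2 = 4 :> R)// -natrX.
have far n j : ip_norm ip (v (n + j)%N - v n) <= 2 * c / 2 ^+ n - 2 * c / 2 ^+ (n + j).
  elim: j => [|j IH].
    rewrite addn0 !subrr /ip_norm (ip0l hD (semi_inner0 hD)) /=.
    by rewrite sqrtr0.
  apply: le_trans (ip_norm_sub_triangle hD (Dv _) (Dv n) (Dv (n + j)%N)) _.
  rewrite addnS; apply: le_trans (lerD (step (n + j)%N) IH) _.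
  rewrite exprS le_eqVlt; apply/orP; left; apply/eqP.
  by field; rewrite !gt_eqF.
apply: cD => // e e0.
have [N HN] : exists N : nat, 4 * c / 2 ^+ N < e.
  have [|N /(_ N (leqnn _)) HN] :=
    cvg0_lt (@cvg_harmonic R) (e := e / (4 * c + 1)).
    by rewrite divr_gt0// ltr_wpDl// mulr_ge0// sqrtr_ge0.
  exists N; have c0 : 0 <= c := sqrtr_ge0 _.
  move: HN; rewrite /= ltr_pdivlMr ?ltr_wpDl ?mulr_ge0// mulrC ltr_pdivrMr// => HN.
  rewrite ltr_pdivrMr//.
  have le2 : N.+1%:R <= 2 ^+ N :> R by rewrite -natrX ler_nat ltn_expl.
  by apply: (@lt_le_trans _ _ (e * N.+1%:R)); [lra|rewrite ler_pM2l].
have near_N n : (N <= n)%N -> ip_norm ip (v n - v N) <= 2 * c / 2 ^+ N.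
  move=> /subnKC <-; apply: le_trans (far _ _) _; rewrite gerBl.
  by rewrite divr_ge0 ?mulr_ge0 ?sqrtr_ge0// ltW.
exists N => m n Nm Nn; apply: le_lt_trans HN.
apply: le_trans (ip_norm_sub_triangle hD (Dv m) (Dv n) (Dv N)) _.
rewrite (ip_norm_distC hD (Dv N) (Dv n)).
by have := near_N _ Nm; have := near_N _ Nn; lra.
Qed.

End SemiInnerLimits.

Lemma limn_einf_le {R : realType} (u : (\bar R)^nat) c :
  (forall n, u n <= c)%E -> (limn_einf u <= c)%E.
Proof.
move=> uc; rewrite limn_einf_lim; apply: lime_le; first exact: is_cvg_einfs.
apply: nearW => n; apply: le_trans (uc n).
by apply: ereal_inf_lbound; exists n => /=.
Qed.

Section DirectIntegral.
Context {R : realType} {X : Type} d (Omega : measurableType d).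
Variables (mu : {measure set Omega -> \bar R}) (H : Omega -> rkhs R X).
Variable M : measurable_structure H.
Implicit Types f g h : Omega -> X -> R[i].

Local Notation ipw w := (rkhs_ip (H w)).
Local Notation q f := (fun w => sqnorm (rkhs_ip (H w)) (f w)).
Local Notation DI := (direct_integral mu M).
Local Notation dip := (di_ip mu H).

Lemma fibre_sqnorm_ge0 f w : cross_section H f -> 0 <= sqnorm (ipw w) (f w).
Proof. by move=> Hf; exact: (sqnorm_ge0 (fibre_semi_inner H w)). Qed.

Lemma di_energyE f : cross_section H f ->
  di_energy mu H f = (\int[mu]_w (q f w)%:E)%E.
Proof.
move=> Hf; apply: eq_integral => w _; congr EFin.
exact: (sqr_ip_norm (fibre_semi_inner H w)).
Qed.

Lemma direct_integral_section f : DI f -> measurable_section M f.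
Proof. by case. Qed.

Lemma direct_integral_cross f : DI f -> cross_section H f.
Proof. by case=> [[]]. Qed.

(** The integrand is controlled by [sqnorm (f + g) <= 2 (sqnorm f + sqnorm g)],
    a consequence of the parallelogram law. *)
Lemma direct_integral_lin a f g : DI f -> DI g -> DI (a *: f + g).
Proof.
move=> [mf ef] [mg eg]; have [Hf _] := mf; have [Hg _] := mg.
have ml := measurable_section_lin a mf mg; split => //.
have Hl := cross_section_lin a Hf Hg.
rewrite /= di_energyE// in ef; rewrite /= di_energyE// in eg.
set c := 2 * (complex.Re a ^+ 2 + complex.Im a ^+ 2).
have c0 : 0 <= c by rewrite mulr_ge0// addr_ge0 ?sqr_ge0.
rewrite /= di_energyE//.
apply: (@le_lt_trans _ _ (\int[mu]_w (c%:E * (q f w)%:E + 2%:E * (q g w)%:E))%E).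
  apply: ge0_le_integral => //.
  - by move=> w _; rewrite lee_fin fibre_sqnorm_ge0.
  - by apply/measurable_EFinP; exact: (measurable_sqnorm ml).
  - apply/measurable_EFinP; apply: measurable_funD;
      apply: measurable_funM; by [exact: measurable_cst|
        exact: (measurable_sqnorm mf)|exact: (measurable_sqnorm mg)].
  move=> w _; rewrite -!EFinM -EFinD lee_fin.
  have hw := fibre_semi_inner H w; have DZ := semi_innerZ hw a (Hf w).
  apply: le_trans (sqnormD_le hw DZ (Hg w)) _.
  by rewrite (sqnormZ hw)// /c; lra.
rewrite ge0_integralD//; last 4 first.
- by move=> w _; rewrite -EFinM lee_fin mulr_ge0 ?fibre_sqnorm_ge0.
- apply/measurable_EFinP; apply: measurable_funM; first exact: measurable_cst.
  exact: (measurable_sqnorm mf).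
- by move=> w _; rewrite -EFinM lee_fin mulr_ge0 ?fibre_sqnorm_ge0.
- apply/measurable_EFinP; apply: measurable_funM; first exact: measurable_cst.
  exact: (measurable_sqnorm mg).
rewrite !ge0_integralZl_EFin//; try by move=> w _; rewrite lee_fin fibre_sqnorm_ge0.
- by rewrite lte_add_pinfty ?lte_mul_pinfty.
- by apply/measurable_EFinP; exact: (measurable_sqnorm mg).
- by apply/measurable_EFinP; exact: (measurable_sqnorm mf).
Qed.

Lemma direct_integral0 : DI 0.
Proof.
split; first exact: measurable_section0.
rewrite /= di_energyE; last by move=> w; exact: (semi_inner0 (fibre_semi_inner H w)).
rewrite integral0_eq// => w _; have hw := fibre_semi_inner H w.
by rewrite /sqnorm (ip0l hw)//; exact: (semi_inner0 hw).
Qed.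

Lemma integrable_sqnorm f : DI f -> mu.-integrable setT (EFin \o q f).
Proof.
move=> [mf ef]; have [Hf _] := mf; apply/integrableP; split.
  by apply/measurable_EFinP; exact: (measurable_sqnorm mf).
move: ef; rewrite /= di_energyE//; congr (_ < _)%E.
by apply: eq_integral => w _; rewrite /= ger0_norm// fibre_sqnorm_ge0.
Qed.

(** By polarization, since [f + g] is in the direct integral. *)
Lemma integrable_Re_ip f g : DI f -> DI g ->
  mu.-integrable setT (EFin \o (fun w => complex.Re (ipw w (f w) (g w)))).
Proof.
move=> df dg; have Hf := direct_integral_cross df; have Hg := direct_integral_cross dg.
have dD : DI (f + g) by rewrite -[f]scale1r; exact: direct_integral_lin.
rewrite [X in integrable _ _ X](_ : _ = fun w => ((2^-1)%:E *
    (((EFin \o q (f + g)%R) \- (EFin \o q f)) \- (EFin \o q g)) w)%E); last first.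
  apply/funext => w /=; rewrite -!EFinB -EFinM; congr EFin.
  by rewrite (Re_ipE (fibre_semi_inner H w)).
apply: integrableZl => //; apply: integrableB => //; last exact: integrable_sqnorm.
by apply: integrableB => //; exact: integrable_sqnorm.
Qed.

Lemma integrable_Im_ip f g : DI f -> DI g ->
  mu.-integrable setT (EFin \o (fun w => complex.Im (ipw w (f w) (g w)))).
Proof.
move=> df dg; have Hf := direct_integral_cross df; have Hg := direct_integral_cross dg.
have di : DI ('i *: g).
  by rewrite -[_ *: _]addr0; apply: direct_integral_lin => //; exact: direct_integral0.
apply: eq_integrable (integrable_Re_ip df di) => // w _ /=.
by rewrite (Im_ipE (fibre_semi_inner H w)).
Qed.

Lemma sqnorm_di_ipE f : sqnorm dip f = Rintegral mu setT (q f).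
Proof. by []. Qed.

Lemma di_energy_sqnorm f : DI f -> di_energy mu H f = (sqnorm dip f)%:E.
Proof.
move=> df; rewrite di_energyE; last exact: direct_integral_cross.
rewrite sqnorm_di_ipE fineK//; apply: integrable_fin_num => //.
exact: integrable_sqnorm.
Qed.

Lemma direct_integral_semi_inner : semi_inner DI dip.
Proof.
split.
- exact: direct_integral0.
- exact: direct_integral_lin.
- move=> a f g h df dg dh.
  have Hf := direct_integral_cross df; have Hg := direct_integral_cross dg.
  have Hh := direct_integral_cross dh.
  have E w : ipw w ((a *: f + g) w) (h w) =
      a * ipw w (f w) (h w) + ipw w (g w) (h w).
    exact: (semi_inner_ip_lin (fibre_semi_inner H w)).
  have iZ r (p : Omega -> R) : mu.-integrable setT (EFin \o p) ->
      mu.-integrable setT (EFin \o (fun w => r * p w)).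
    by move=> ip; apply: eq_integrable (integrableZl measurableT r ip).
  have i1 := integrable_Re_ip df dh; have i2 := integrable_Im_ip df dh.
  have i3 := integrable_Re_ip dg dh; have i4 := integrable_Im_ip dg dh.
  apply: eq_ReIm; rewrite !reimE /di_ip /cintegral /=;
    under eq_Rintegral do rewrite E !reimE.
  + rewrite RintegralD//; last first.
      apply: eq_integrable (integrableB measurableT (iZ _ _ i1) (iZ _ _ i2)) => //.
    by rewrite RintegralB ?RintegralZl//; exact: iZ.
  + rewrite RintegralD//; last first.
      apply: eq_integrable (integrableD measurableT (iZ _ _ i2) (iZ _ _ i1)) => //.
    by rewrite RintegralD ?RintegralZl//; exact: iZ.
- move=> f g df dg.
  have E w : ipw w (g w) (f w) = (ipw w (f w) (g w))^*.
    apply: (semi_inner_herm (fibre_semi_inner H w));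
      by [exact: (direct_integral_cross df)|exact: (direct_integral_cross dg)].
  apply: eq_ReIm; rewrite !reimE /di_ip /cintegral /=;
    under eq_Rintegral do rewrite E !reimE; first by [].
  under eq_Rintegral do rewrite -mulN1r.
  rewrite RintegralZl// ?mulN1r//; exact: integrable_Im_ip.
- move=> f df; have Hf := direct_integral_cross df.
  rewrite lecE; apply/andP; split; rewrite /di_ip /cintegral /=.
    under eq_Rintegral do rewrite (Im_ip_diag (fibre_semi_inner H _))//.
    by rewrite Rintegral_cst// mul0r.
  by apply: Rintegral_ge0 => w _; exact: fibre_sqnorm_ge0.
Qed.


(** Fatou's lemma turns convergence of [v] to [f] in almost every fibre into an
    estimate of the distance to [f] in the direct integral. *)
Lemma direct_integral_fatou g f (v : nat -> Omega -> X -> R[i])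
    (A : set Omega) (c : R) :
  measurable A -> mu A = 0%E -> measurable_section M f ->
  DI g -> (forall k, DI (v k)) ->
  (forall w, ~ A w ->
    (fun k => ip_norm (ipw w) (v k w - f w)) @ \oo --> (0 : R)) ->
  (forall k, sqnorm dip (g - v k) <= c) ->
  DI (g - f) /\ sqnorm dip (g - f) <= c.
Proof.
move=> mA A0 mf dg dv vf vc; have hd := direct_integral_semi_inner.
have Hg := direct_integral_cross dg; have [Hf _] := mf.
have Hv k := direct_integral_cross (dv k).
have mB : measurable_section M (g - f).
  rewrite addrC -scaleN1r; apply: measurable_section_lin => //.
  exact: direct_integral_section.
have [HB _] := mB; have dB k := semi_innerB hd dg (dv k).
have HBk k := direct_integral_cross (dB k).
have mq k : measurable_fun setT (EFin \o q (g - v k)).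
  apply/measurable_EFinP; apply: measurable_sqnorm.
  exact: direct_integral_section.
have mCA : measurable (~` A) by exact: measurableC.
suff le_c : (di_energy mu H (g - f)%R <= c%:E)%E.
  have dgf : DI (g - f) by split => //; exact: le_lt_trans le_c (ltry _).
  by split => //; rewrite -lee_fin -di_energy_sqnorm.
have q0 h w : cross_section H h -> (0 <= (q h w)%:E)%E.
  by move=> Hh; rewrite lee_fin fibre_sqnorm_ge0.
rewrite di_energyE// (ge0_negligible_integral mA)//; last 2 first.
- by apply/measurable_EFinP; exact: (measurable_sqnorm mB).
- by move=> w _; exact: q0.
rewrite setTD.
rewrite (eq_integral (fun w => limn_einf (fun k => (q (g - v k) w)%:E))); last first.
  move=> w; rewrite inE => Aw; apply/esym.
  apply: (cvg_limn_einf_sup _).1; apply: cvg_EFin; first exact: nearW.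
  apply: (sqnorm_cvg (fibre_semi_inner H w) (Hg w) (Hf w) (fun k => Hv k w) (vf w Aw)).
apply: le_trans (fatou mu mCA _ _) _.
- by move=> k; apply: measurable_funTS; exact: mq.
- by move=> k w _; apply: q0.
apply: limn_einf_le => k.
apply: (@le_trans _ _ (\int[mu]_w (q (g - v k)%R w)%:E)%E).
  by apply: ge0_subset_integral => //; [exact: mq|move=> w _; exact: q0].
by rewrite -di_energyE// di_energy_sqnorm// lee_fin.
Qed.

(** A subsequence whose consecutive squared distances decay geometrically
    converges almost everywhere: the series of the squared distances weighted
    by [4 ^+ k] has a finite integral. *)
Lemma ae_cvg_of_fast_cauchy (v : nat -> Omega -> X -> R[i]) :
  (forall k, DI (v k)) ->
  (forall k, sqnorm dip (v k.+1 - v k) <= (16^-1) ^+ k.+1) ->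
  exists A f, [/\ measurable A, mu A = 0%E, measurable_section M f &
    forall w, ~ A w ->
      (fun k => ip_norm (ipw w) (v k w - f w)) @ \oo --> (0 : R)].
Proof.
move=> dv vstep; have hd := direct_integral_semi_inner.
have dB k := semi_innerB hd (dv k.+1) (dv k).
have HB k := direct_integral_cross (dB k).
have Hv k := direct_integral_cross (dv k).
pose G w := (\sum_(0 <= k <oo) (4 ^+ k * q (v k.+1 - v k)%R w)%:E)%E.
have t0 k w : (0 <= (4 ^+ k * q (v k.+1 - v k)%R w)%:E)%E.
  by rewrite lee_fin mulr_ge0 ?exprn_ge0 ?fibre_sqnorm_ge0.
have mq k : measurable_fun setT (q (v k.+1 - v k)).
  by apply: measurable_sqnorm; exact: direct_integral_section.
have mt k : measurable_fun setT (fun w => (4 ^+ k * q (v k.+1 - v k) w)%:E).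
  by apply/measurable_EFinP; apply: measurable_funM => //; exact: measurable_cst.
have G0 w : (0 <= G w)%E by apply: nneseries_ge0 => k _ _; exact: t0.
have mG : measurable_fun setT G.
  by apply: (@ge0_emeasurable_sum _ _ _ _ _ xpredT) => k *; [exact: t0|exact: mt].
have intG : (\int[mu]_w G w < +oo)%E.
  rewrite integral_nneseries//.
  apply: le_lt_trans (ltry 1); apply: le_trans (epsilon_trick0 xpredT ler01).
  apply: lee_nneseries => [k _ _|k _]; first by apply: integral_ge0 => w _; exact: t0.
  under eq_integral do rewrite EFinM.
  rewrite ge0_integralZl_EFin//; last 2 first.
  - by move=> w _; rewrite lee_fin fibre_sqnorm_ge0.
  - exact/measurable_EFinP.
  rewrite -di_energyE// di_energy_sqnorm// -EFinM lee_fin.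
  have p4 : 0 <= 4 ^+ k :> R by rewrite exprn_ge0.
  (* 4 ^ k / 16 ^ (k + 1) <= 1 / 4 ^ (k + 1) <= 1 / 2 ^ (k + 1), the terms of a
     series with sum 1. *)
  apply: le_trans (ler_wpM2l p4 (vstep k)) _.
  rewrite exprS mulrCA -exprMn mul1r natrX.
  rewrite (_ : 4 * 16^-1 = 4^-1 :> R); last by field.
  apply: (@le_trans _ _ (4^-1 ^+ k.+1)).
    by rewrite exprS ler_wpM2r ?exprn_ge0// lef_pV2 ?posrE// ler_nat.
  by rewrite -exprVn lerXn2r ?nnegrE// lef_pV2 ?posrE// ler_nat.
have iG : mu.-integrable setT G.
  apply/integrableP; split => //; under eq_integral do rewrite gee0_abs//.
  exact: intG.
have [A [mA muA GA]] := integrable_ae measurableT iG.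
have limw w : exists l, rkhs_space (H w) l /\ if `[< A w >] then l = 0 else
    (fun k => ip_norm (ipw w) (v k w - l)) @ \oo --> (0 : R).
  have hw := fibre_semi_inner H w.
  case: asboolP => Aw; first by exists 0; split => //; exact: (semi_inner0 hw).
  have Gfin : G w \is a fin_num.
    by apply: contrapT => Gw; apply: Aw; apply: GA => /= /(_ I).
  have [|k|l Hl lP] := @cvg_geometric_steps _ _ _ _ hw (v ^~ w) (fine (G w))
    (@fibre_complete _ _ _ _ H w); last by exists l.
    by move=> k; exact: Hv.
  rewrite -lee_fin fineK//; apply: le_trans (nneseries_lim_ge k.+1 _) => [|j _ _].
    by rewrite big_nat_recr//= leeDr// sume_ge0 => // j _; exact: t0.
  exact: t0.
have /choice[f fP] := limw; have Hf w : rkhs_space (H w) (f w) := (fP w).1.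
exists A, f; split => //; last first.
  by move=> w Aw; have := (fP w).2; case: asboolP.
apply: (measurable_section_cvg
  (u := fun k w => if `[< A w >] then 0 else v k w)) => //.
  move=> k; apply: measurable_section_restrict => //.
  exact: direct_integral_section.
move=> w; have := (fP w).2; case: asboolP => // _ ->; rewrite subr0.
have hw := fibre_semi_inner H w.
by rewrite /ip_norm (ip0l hw (semi_inner0 hw)) /= sqrtr0; exact: cvg_cst.
Qed.

(** Riesz-Fischer. The limit [f] of a fast subsequence is only known to be a
    measurable section; that it is in the direct integral comes from
    [u n - f] being so. *)
Lemma direct_integral_complete : cauchy_complete DI dip.
Proof.
move=> u du ucauchy; have hd := direct_integral_semi_inner.
have /choice[N0 N0P] (k : nat) : exists N, forall m n, (N <= m)%N ->
    (N <= n)%N -> ip_norm dip (u m - u n) < 4^-1 ^+ k.+1.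
  by apply: ucauchy; rewrite exprn_gt0// invr_gt0.
(* A sum of thresholds exceeds each of them, so phi k and phi k.+1 are both
   beyond the k-th one; the added k makes phi unbounded. *)
pose phi k := (\sum_(j < k.+1) N0 j + k)%N.
have N0_phi k : (N0 k <= phi k)%N.
  by rewrite /phi big_ord_recr/= -addnA addnCA leq_addr.
have N0_phiS k : (N0 k <= phi k.+1)%N.
  by rewrite /phi 2!big_ord_recr/= -!addnA addnCA leq_addr.
pose v k := u (phi k); have dv k : DI (v k) by exact: du.
have vstep k : sqnorm dip (v k.+1 - v k) <= (16^-1) ^+ k.+1.
  have dB := semi_innerB hd (dv k.+1) (dv k).
  rewrite (_ : 16^-1 = 4^-1 ^+ 2 :> R); last by field.
  rewrite -(sqr_ip_norm hd)// exprAC lerXn2r ?nnegrE ?ip_norm_ge0 ?exprn_ge0//.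
  by apply/ltW/N0P.
have [A [f [mA A0 mf vf]]] := ae_cvg_of_fast_cauchy dv vstep.
have dist (e : R) : 0 < e -> exists N : nat, forall n, (N <= n)%N ->
    DI (u n - f) /\ sqnorm dip (u n - f) <= e ^+ 2.
  move=> e0; have [N HN] := ucauchy e e0; exists N => n Nn.
  apply: (@direct_integral_fatou _ _ (fun k => v (k + N)%N) A) => //.
    move=> w Aw; have := vf w Aw.
    by rewrite -(cvg_shiftn N); exact.
  move=> k; have dB := semi_innerB hd (du n) (dv (k + N)%N).
  rewrite -(sqr_ip_norm hd)// lerXn2r ?nnegrE ?ip_norm_ge0 ?(ltW e0)//.
  by apply/ltW/HN => //; rewrite /phi addnA leq_addl.
have [N /(_ N (leqnn _))[dNf _]] := dist 1 ltr01.
have df : DI f by have := semi_innerB hd (du N) dNf; rewrite opprB addrC subrK.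
exists f => //; apply: lt_cvg0 => [n|e e0]; first exact: ip_norm_ge0.
have [|K HK] := dist (e / 2); first by rewrite divr_gt0.
exists K => n Kn; have [dB le_e] := HK n Kn.
apply: (@le_lt_trans _ _ (e / 2)); last by lra.
rewrite -(@ler_pXn2r _ 2)// ?nnegrE ?ip_norm_ge0 ?(sqr_ip_norm hd)//.
by rewrite divr_ge0// ltW.
Qed.

Lemma cintegrable_ip f g : DI f -> DI g ->
  cintegrable mu (fun w => rkhs_ip (H w) (f w) (g w)).
Proof.
by move=> df dg; split; [exact: integrable_Re_ip|exact: integrable_Im_ip].
Qed.

Lemma direct_integral_evalE f x w : DI f ->
  f w x = rkhs_ip (H w) (f w) (kernel_section H x w).
Proof. by move=> df; apply: rkhs_reproducing; exact: direct_integral_cross. Qed.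

(** The reproducing property in each fibre, integrated; this is what makes
    summation an instance of the abstract setting of [image_rkhs]. *)
Lemma summationE f x : DI f ->
  summation mu f x = dip f (kernel_section H x).
Proof.
move=> df; rewrite /summation /di_ip; congr cintegral; apply/funext => w.
exact: direct_integral_evalE.
Qed.

End DirectIntegral.

(** * Summation over the direct integral *)

Theorem theorem3p1 (R : realType) (X : Type) (d : measure_display)
    (Omega : measurableType d) (mu : {measure set Omega -> \bar R})
    (H : Omega -> rkhs R X) (M : measurable_structure H)
    (hK : forall x, direct_integral mu M (kernel_section H x)) :
  (forall f, direct_integral mu M f ->
     forall x, cintegrable mu (fun w => f w x)) /\
  (exists HH : rkhs R X,
    [/\ rkhs_space HH = summation mu @` direct_integral mu M,
        forall x y,
          rkhs_kernel HH x y = cintegral mu (fun w => rkhs_kernel (H w) x y) &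
        forall f, rkhs_space HH f ->
          ((rkhs_norm HH f ^+ 2)%:E =
           ereal_inf [set di_energy mu H g | g in
             direct_integral mu M `&` [set g | f = summation mu g]])%E]) /\
  (forall x,
    di_orthogonal mu M (summation_null mu M) (kernel_section H x) /\
    (di_norm mu H (kernel_section H x) ^+ 2)%:C =
      cintegral mu (fun w => rkhs_kernel (H w) x x)).
Proof.
have hd := direct_integral_semi_inner mu M.
have cd : cauchy_complete (direct_integral mu M) (di_ip mu H).
  exact: direct_integral_complete.
have SE f x : direct_integral mu M f ->
    summation mu f x = di_ip mu H f (kernel_section H x).
  exact: summationE.
split; last split.
- move=> f df x; have := cintegrable_ip df (hK x).
  rewrite (_ : (fun w => rkhs_ip _ _ _) = fun w => f w x)//.
  by apply/funext => w; rewrite -(direct_integral_evalE _ _ df).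
- have [HH [HHE KE normE]] := image_rkhs hd cd hK SE.
  exists HH; split => // f /normE[g [dg gf -> gmin]].
  rewrite (sqr_ip_norm hd)// -(di_energy_sqnorm dg); apply/le_anti/andP; split.
    apply/ereal_infP => _ [g' [dg' fg'] <-].
    rewrite (di_energy_sqnorm dg) (di_energy_sqnorm dg') lee_fin.
    rewrite -!(sqr_ip_norm hd)// lerXn2r ?nnegrE ?ip_norm_ge0//.
    exact: gmin.
  by apply: ereal_inf_lbound; exists g.
move=> x; split.
  split; first exact: hK.
  by move=> f [df /= f0]; rewrite -SE// f0.
rewrite /di_norm (sqr_ip_norm hd)//.
by rewrite -(ip_diagE hd)// -SE.
Qed.
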